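(* Let $m\ge 2$ and let $p_j=(x_j,y_j)^T\in\mathbb{R}^2$, $j=1,\ldots,m$, be points such that $x_j\neq x_k$ for all $j\neq k$. Let $f(a,b)=\max_{j=1,\ldots,m}|y_j-ax_j-b|$ for $(a,b)\in\mathbb{R}^2$. There exists a unique linear function $y(x)=ax+b$ with minimal algebraic $L^\infty$-distance to the set $\{p_1,\ldots,p_m\}$, i.e. a unique $(a,b)\in\mathbb{R}^2$ at which $f$ attains its global minimum. Moreover, $$\min_{a,b\in\mathbb{R}}f(a,b)=\min_{a,b\in\mathbb{R}}\max_{j=1,\ldots,m}|y_j-ax_j-b|=\min_{a,b\in\mathbb{R}}\max_{p_j\in V}|y_j-ax_j-b|=\frac12\min_{S_{kl}\subset\partial P}\ \max_{p_j\in V}\left|y_j-y_k-\frac{y_k-y_l}{x_k-x_l}(x_j-x_k)\right|.$$ If $0<f(a_0,b_0)=\min\{f(a,b):a,b\in\mathbb{R}\}$, then there exist pairwise distinct indices $k_1,k_2,k_3$ with $p_{k_1},p_{k_2},p_{k_3}\in V$ such that $f(a_0,b_0)=|y_{k_i}-a_0x_{k_i}-b_0|$ for $i=1,2,3$ and $S_{k_1k_2}\subset\partial P$.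
   Context: $P$ denotes the convex hull of $\{p_1,\ldots,p_m\}$ (smallest convex set containing these points) and $\partial P$ its topological boundary in $\mathbb{R}^2$. $V$ is the set of vertices of $P$: $V=\{p_k : p_k\text{ is not in the convex hull of }\{p_j:j\neq k\}\}$. For $k\neq l$ with $p_k,p_l\in V$, $S_{kl}=\{p_l+t(p_k-p_l):0\le t\le1\}$ is the segment joining $p_k$ and $p_l$. The minimum over $S_{kl}\subset\partial P$ is taken over all pairs $k\neq l$ with $p_k,p_l\in V$ and $S_{kl}\subset\partial P$. *)

(* Defs.v *)
From mathcomp Require Import all_boot all_order all_algebra.
From mathcomp Require Import all_classical all_reals all_analysis.

Set Implicit Arguments.
Unset Strict Implicit.
Unset Printing Implicit Defensive.

Import Order.TTheory GRing.Theory Num.Theory.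
Import numFieldNormedType.Exports.

Local Open Scope classical_set_scope.
Local Open Scope ring_scope.

(* [R^o] rather than [R], so that the product is an [R]-module as well as a
   topological space (with the product topology) *)
Definition plane (R : realType) : normedModType R := (R^o * R^o)%type.

Definition convex_hull (R : realType) (A : set (plane R)) : set (plane R) :=
  smallest (@convex_set R (plane R)) A.

Definition boundary (T : topologicalType) (A : set T) : set T :=
  closure A `\` interior A.

Definition segment (R : realType) (u v : plane R) : set (plane R) :=
  [set v + t *: (u - v) | t in `[0 : R, 1]].

Definition is_min (R : realType) (A : set R) (v : R) : Prop :=
  A v /\ lbound A v.

Section configuration.
Context (R : realType) (m : nat) (x y : 'I_m -> R).

Definition pt (j : 'I_m) : plane R := (x j, y j).

Definition polygon : set (plane R) := convex_hull (range pt).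

Definition vertices : set (plane R) :=
  pt @` [set k | ~ convex_hull (pt @` [set j | j != k]) (pt k)].

(* The default value 0 of the three maxima below is harmless: the values are
   nonnegative, and [vertices] is nonempty as soon as [0 < m]. *)
Definition linf_dist (a b : R) : R :=
  \big[Num.max/0]_(j < m) `|y j - a * x j - b|.

Definition linf_dist_vertices (a b : R) : R :=
  \big[Num.max/0]_(j < m | pt j \in vertices) `|y j - a * x j - b|.

Definition edge_dist (k l : 'I_m) : R :=
  \big[Num.max/0]_(j < m | pt j \in vertices)
    `|y j - y k - (y k - y l) / (x k - x l) * (x j - x k)|.

Definition boundary_edge (k l : 'I_m) : Prop :=
  [/\ k != l, vertices (pt k), vertices (pt l)
    & segment (pt k) (pt l) `<=` boundary polygon].

End configuration.

(* Main.v *)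
Require Import Defs.
From mathcomp Require Import all_boot all_order all_algebra.
From mathcomp Require Import all_classical all_reals all_analysis.
From mathcomp Require Import ring lra.

Set Implicit Arguments.
Unset Strict Implicit.
Unset Printing Implicit Defensive.

Import Order.TTheory GRing.Theory Num.Theory.
Import numFieldNormedType.Exports.

Local Open Scope classical_set_scope.
Local Open Scope ring_scope.

(** Why the theorem holds.  Write [r j = y j - a * x j - b] for the residual of
    the [j]-th point.  The key notion is a Chebyshev line ([chebyshev_line]): all
    residuals lie in [[-e, e]], and there are two pairs of points, each pair
    consisting of a point of residual [e] and one of residual [-e], such that
    the high point is to the right of the low one in the first pair and to its
    left in the second.

    Such a line is the unique best one, with value [e].  Any line whose
    residuals are bounded by [e' <= e] has, on each of the two pairs, a spread
    of at most [2 * e'] instead of [2 * e]; the first pair then forces its slope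
    to be at least [a] and the second forces it to be at most [a]
    ([chebyshev_line_le], [chebyshev_line_unique]).

    Such a line exists.  Once the slope is fixed, the best offset puts the line
    halfway between the extreme values of [y j - a * x j], so the optimal value
    is half the largest [|(y i - y j) - a * (x i - x j)|] over the pairs with
    [x j < x i].  Minimising in the single real [a] the greatest deviation
    [|c s - a * d s|] of a finite family, with all [d s > 0], is solved by a
    maximisation over pairs of indices ([ratio_minimax]); the two terms of
    opposite signs that are active at the optimum are the two pairs required
    above.

    The link with the polygon comes from supporting lines.  The high points of
    a Chebyshev line lie on a line that supports [P] from above, the low points
    on a parallel line that supports it from below.  The two pairs cannot
    both use the same high point and the same low point, so one of the two
    supporting lines carries two of the points.  Its leftmost and rightmost
    points are vertices, found as lexicographic maxima
    ([exists_lex_max_vertex]), and the segment joining them lies in the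
    boundary of [P] ([support_segment]).  A vertex on the opposite supporting
    line is the third index, and the distance of that line to the edge gives
    the edge the value [2 * e] ([chebyshev_line_edge]).

    Conversely, if the segment joining two of the points lies in the boundary
    of [P], then all points are on one side of its line: points on both sides
    would make its midpoint an interior one ([boundary_edge_one_sided]).
    Residuals with respect to the edge then range over [[0, D]] or [[-D, 0]]
    with [D] the value of the edge, and shifting the line by [D / 2] shows
    [e <= D / 2] ([chebyshev_line_edge_dist]). *)

(** * Best approximation of a finite family by a multiple of another *)

Section ratio_minimax.
Context {R : realType}.

(** For a pair [(p, q)], no [a] can make both [c p - a * d p] and
    [a * d q - c q] smaller than their common value at the [a] that equalises
    them, which is [F (p, q)] below.  At a pair that maximises this lower bound,
    the bound is attained: if some [s] exceeded it at that [a] from above, the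
    pair [(s, q)] would give a larger [F], and if from below, the pair [(p, s)]
    would. *)
Lemma ratio_minimax (T : finType) (P : pred T) (c d : T -> R) (t0 : T) :
  P t0 -> (forall s, P s -> 0 < d s) ->
  exists (a v : R) (p q : T),
    [/\ P p, P q, c p - a * d p = v, a * d q - c q = v
      & forall s, P s -> `|c s - a * d s| <= v].
Proof.
move=> Pt0 d_gt0.
pose F (pq : T * T) :=
  (c pq.1 * d pq.2 - c pq.2 * d pq.1) / (d pq.1 + d pq.2).
have := @arg_maxP _ _ _ (t0, t0) [pred pq : T * T | P pq.1 && P pq.2] F.
rewrite /= Pt0 => /(_ isT) [] [p q] /= /andP[Pp Pq] Fmax.
have dp := d_gt0 _ Pp; have dq := d_gt0 _ Pq.
set a := (c p + c q) / (d p + d q).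
have ea : a * (d p + d q) = c p + c q.
  by rewrite /a mulfVK// gt_eqF// addr_gt0.
have vE : F (p, q) = c p - a * d p.
  by rewrite /F /a /=; field; rewrite gt_eqF// addr_gt0.
exists a, (c p - a * d p), p, q; split=> //; first by lra.
move=> s Ps; have ds := d_gt0 _ Ps.
rewrite -vE ler_norml; apply/andP; split.
- have := Fmax (p, s); rewrite /= Pp Ps => /(_ isT).
  rewrite {1}/F /= ler_pdivrMr ?addr_gt0// vE => H.
  rewrite -(ler_pM2l dp); nra.
- have := Fmax (s, q); rewrite /= Pq Ps => /(_ isT).
  rewrite {1}/F /= ler_pdivrMr ?addr_gt0// vE => H.
  rewrite -(ler_pM2l dq); nra.
Qed.

End ratio_minimax.

(** * The equioscillating line *)

Section chebyshev_line.
Context {R : realType} {m : nat} (x y : 'I_m -> R).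

Let r (a b : R) (j : 'I_m) := y j - a * x j - b.

(** The letters [u] and [d] stand for points up and down the line.  Nothing
    prevents [u = u'] or [d = d'], and [e = 0] is allowed: a line through all
    points is a Chebyshev line.  When [e] is positive, this is equivalent to the
    classical alternation of signs on three points of increasing abscissa. *)
Definition chebyshev_line (a b e : R) : Prop :=
  (forall j, `|r a b j| <= e) /\
  exists u d u' d' : 'I_m,
    [/\ x d < x u, x u' < x d', r a b u = e /\ r a b d = - e
      & r a b u' = e /\ r a b d' = - e].

(** The finite family handed to [ratio_minimax] is indexed by the pairs of
    points ordered by abscissa, with [c] the difference of ordinates and [d] the
    difference of abscissas: [c - a * d] is then the difference of two
    residuals, whatever the offset. *)
Lemma chebyshev_line_exists :
  (2 <= m)%N -> (forall j k : 'I_m, j != k -> x j != x k) ->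
  exists a b e, chebyshev_line a b e.
Proof.
move=> hm hx.
have [p0 Pp0] : exists p : 'I_m * 'I_m, x p.2 < x p.1.
  pose i0 : 'I_m := Ordinal (ltnW hm); pose i1 : 'I_m := Ordinal hm.
  have /hx : i0 != i1 by [].
  by case: ltgtP => // h _; [exists (i1, i0)|exists (i0, i1)].
have [a [v [[u d] [[d' u'] [/= xdu xud uE dE vmax]]]]] :=
  @ratio_minimax R _ [pred p : 'I_m * 'I_m | x p.2 < x p.1]
    (fun p => y p.1 - y p.2) (fun p => x p.1 - x p.2) p0 Pp0
    (fun s Ps => ltac:(by rewrite subr_gt0)).
have spread i j : (y i - a * x i) - (y j - a * x j) <= v.
  have v_ge0 : 0 <= v by apply: le_trans (vmax _ Pp0).
  have [<-|/hx] := eqVneq i j; first by rewrite subrr.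
  case: (ltgtP (x i) (x j)) => // h _.
  - by have := vmax (j, i) h; rewrite /= ler_norml => /andP[]; lra.
  - by have := vmax (i, j) h; rewrite /= ler_norml => /andP[]; lra.
(* this offset gives [u] the residual [v / 2] *)
exists a, (y u - a * x u - v / 2), (v / 2); split.
  move=> j; rewrite /r ler_norml; have := spread u j; have := spread j u.
  have := spread j d; move=> *; apply/andP; split; lra.
have := spread u' d; have := spread u d'.
exists u, d, u', d'; split=> //; rewrite /r; split; lra.
Qed.

(** The spread of the residuals on the pair [u, d] exceeds [2 * e] if the slope
    decreases, and the spread on [u', d'] does if it increases. *)
Lemma chebyshev_line_le a b e a' b' e' :
  chebyshev_line a b e -> (forall j, `|r a' b' j| <= e') -> e <= e'.
Proof.
rewrite /chebyshev_line /r.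
move=> [_ [u [d [u' [d' [du ud [uE dE] [uE' dE']]]]]]] le_e'.
have bound j : - e' <= y j - a' * x j - b' <= e' by rewrite -ler_norml.
have /andP[_ h1] := bound u; have /andP[_ h2] := bound u'.
have /andP[h3 _] := bound d; have /andP[h4 _] := bound d'.
rewrite leNgt; apply/negP => lt_e.
have [|] := leP a' a; nra.
Qed.

Lemma chebyshev_line_unique a b e a' b' :
  chebyshev_line a b e -> (forall j, `|r a' b' j| <= e) -> a' = a /\ b' = b.
Proof.
rewrite /chebyshev_line /r.
move=> [_ [u [d [u' [d' [du ud [uE dE] [uE' dE']]]]]]] le_e'.
have bound j : - e <= y j - a' * x j - b' <= e by rewrite -ler_norml.
have /andP[_ h1] := bound u; have /andP[_ h2] := bound u'.
have /andP[h3 _] := bound d; have /andP[h4 _] := bound d'.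
have aE : a' = a.
  apply/eqP; rewrite eq_le; apply/andP; split; rewrite leNgt; apply/negP; nra.
by split=> //; apply/eqP; rewrite eq_le; apply/andP; split; subst a'; lra.
Qed.

End chebyshev_line.

(** * Convex sets and affine functions in the plane *)

Section hull.
Context {R : realType}.
Implicit Types (A : set (plane R)) (f g : plane R -> R) (p q : plane R).

Definition affine f : Prop :=
  forall (t : R) p q, f (t *: p + (1 - t) *: q) = t * f p + (1 - t) * f q.

Lemma convex_set_conv A (t : R) p q : @convex_set R (plane R) A ->
  0 <= t <= 1 -> A p -> A q -> A (t *: p + (1 - t) *: q).
Proof.
move=> cA /andP[t0 t1] Ap Aq.
by have := cA p q (Itv01 t0 t1); rewrite !inE; apply.
Qed.

Lemma open_conv_convex_set A :
  (forall (t : R) p q, 0 < t < 1 -> A p -> A q -> A (t *: p + (1 - t) *: q)) ->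
  @convex_set R (plane R) A.
Proof.
move=> cA; apply/convex_setW => p q; rewrite !inE => Ap Aq t t0 t1.
by rewrite inE; apply: cA => //; rewrite t0.
Qed.

Lemma convex_hull_convex A : @convex_set R (plane R) (convex_hull A).
Proof.
apply: open_conv_convex_set => t p q /andP[t0 t1] Ap Aq X [cX AX].
by apply: convex_set_conv => //; [rewrite !ltW|exact: Ap|exact: Aq].
Qed.

Lemma convex_halfplane f (c : R) :
  affine f -> @convex_set R (plane R) [set p | f p <= c].
Proof.
move=> f_aff; apply: open_conv_convex_set => t p q /andP[t0 t1] /= fp fq.
rewrite f_aff; nra.
Qed.

(** When [f] and [g] are independent, this is a lexicographic half-plane: an
    open half-plane together with an open ray of its boundary line. *)
Lemma convex_lex f g (c c' : R) : affine f -> affine g ->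
  @convex_set R (plane R) [set p | f p < c \/ f p = c /\ g p < c'].
Proof.
move=> f_aff g_aff; apply: open_conv_convex_set => t p q /andP[t0 t1] /=.
rewrite f_aff g_aff.
by case=> [fp|[-> gp]] [fq|[-> gq]]; [left|left|left|right; split]; nra.
Qed.

Lemma convex_combination3 A (p q w : plane R) (al be ga : R) :
  @convex_set R (plane R) A -> A p -> A q -> A w ->
  0 < al -> 0 < be -> 0 <= ga -> al + be + ga = 1 ->
  A (al *: p + be *: q + ga *: w).
Proof.
move=> cA Ap Aq Aw al0 be0 ga0 sum1.
have ab0 : 0 < al + be by rewrite addr_gt0.
have Apq : A ((al / (al + be)) *: p + (be / (al + be)) *: q).
  have -> : be / (al + be) = 1 - al / (al + be) by field; rewrite gt_eqF.
  apply: convex_set_conv => //.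
  by rewrite divr_ge0 ?ltW//= ltr_pdivrMr// mul1r ltrDl.
have := @convex_set_conv A ga _ _ cA _ Aw Apq.
have -> : 1 - ga = al + be by lra.
rewrite scalerDr !scalerA !(mulrC (al + be)) !divfK ?gt_eqF// addrC.
by apply; rewrite ga0/=; lra.
Qed.

(** Moving slightly from [p] towards [w] increases [f] beyond its maximum on
    [A], so [p] is a limit of points outside [A]. *)
Lemma boundary_support A f (w p : plane R) :
  affine f -> A p -> (forall q, A q -> f q <= f p) -> f p < f w ->
  boundary A p.
Proof.
move=> f_aff Ap fA fw; split; first exact: subset_closure.
rewrite /interior => /= nbA.
have : \forall t \near (0 : R)^'+, A (t *: w + (1 - t) *: p).
  apply: (_ : t *: w + (1 - t) *: p @[t --> (0:R)^'+] --> p) nbA.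
  rewrite -[X in _ --> X](_ : 0 *: w + (1 - 0) *: p = p); last first.
    by rewrite scale0r add0r subr0 scale1r.
  apply: cvg_at_right_filter.
  apply: cvgD; first by apply: cvgZr_tmp; exact: cvg_id.
  by apply: cvgZr_tmp; apply: cvgB; [exact: cvg_cst|exact: cvg_id].
move=> nearA.
have [t [At t0]] : exists t : R, A (t *: w + (1 - t) *: p) /\ 0 < t.
  near (0 : R)^'+ => t; exists t; split; first by near: t.
  by near: t; exact: nbhs_right_gt.
have := fA _ At; rewrite f_aff; nra.
Unshelve. all: by end_near.
Qed.

Lemma near_affine_pos (u v w : R) (p0 : plane R) :
  0 < u * p0.1 + v * p0.2 + w ->
  \forall p \near p0, 0 < u * p.1 + v * p.2 + w.
Proof.
move=> h.
have : u * p.1 + v * p.2 + w @[p --> p0] --> (u * p0.1 + v * p0.2 + w : R^o).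
  apply: cvgD; last exact: cvg_cst.
  by apply: cvgD; apply: cvgM;
    [exact: cvg_cst|exact: cvg_fst|exact: cvg_cst|exact: cvg_snd].
by move=> /(_ _ (lt_nbhsr h)).
Qed.

Lemma scale_pair (t u v : R) :
  t *: ((u, v) : plane R) = (t * u, t * v) :> plane R.
Proof. by []. Qed.

(** Barycentric coordinates with respect to the triangle [p], [q], [w] are
    affine, hence continuous.  The coordinates [al] and [be] of [p] and [q] are
    both [1 / 2] at the midpoint, so they remain positive nearby; the coordinate
    [ga] of [w] is the quotient in the statement, nonnegative exactly on the
    side of the line [p q] that contains [w]. *)
Lemma near_midpoint_triangle A (a b : R) (p q w : plane R) :
  @convex_set R (plane R) A -> A p -> A q -> A w ->
  p.1 != q.1 ->
  p.2 - a * p.1 - b = 0 -> q.2 - a * q.1 - b = 0 ->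
  w.2 - a * w.1 - b != 0 ->
  \forall z \near 2^-1 *: p + (1 - 2^-1) *: q,
    0 <= (z.2 - a * z.1 - b) / (w.2 - a * w.1 - b) -> A z.
Proof.
move=> cA Ap Aq Aw pq p0 q0 w0.
move: p q w => [p1 p2] [q1 q2] [w1 w2] /= in Ap Aq Aw pq p0 q0 w0 *.
have p2E : p2 = a * p1 + b by lra.
have q2E : q2 = a * q1 + b by lra.
subst p2 q2; have {pq} pq : p1 - q1 != 0 by rewrite subr_eq0.
set h := (w2 - a * w1 - b)^-1.
pose ga (z : plane R) := (z.2 - a * z.1 - b) * h.
pose al (z : plane R) := (z.1 - ga z * w1 - (1 - ga z) * q1) / (p1 - q1).
pose mid : plane R := 2^-1 *: (p1, a * p1 + b) + (1 - 2^-1) *: (q1, a * q1 + b).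
have al_near : \forall z \near mid, 0 < al z.
  pose g := (p1 - q1)^-1.
  have alE z : al z = (g + g * (w1 - q1) * h * a) * z.1
      + (- g * (w1 - q1) * h) * z.2 + (g * (w1 - q1) * h * b - g * q1).
    by rewrite /al /ga -/g; ring.
  suff : 0 < al mid.
    by rewrite alE => /near_affine_pos; apply: filterS => z; rewrite -alE.
  rewrite (_ : al mid = 2^-1) ?invr_gt0// /al /ga /=.
  by rewrite /GRing.scale/=; field.
have be_near : \forall z \near mid, 0 < 1 - ga z - al z.
  pose g := (q1 - p1)^-1.
  have beE z : 1 - ga z - al z = (g + g * (w1 - p1) * h * a) * z.1
      + (- g * (w1 - p1) * h) * z.2 + (g * (w1 - p1) * h * b - g * p1).
    by rewrite /al /ga /g -[q1 - p1]opprB; field.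
  suff : 0 < 1 - ga mid - al mid.
    by rewrite beE => /near_affine_pos; apply: filterS => z; rewrite -beE.
  rewrite (_ : 1 - ga mid - al mid = 2^-1) ?invr_gt0// /al /ga /=.
  by rewrite /GRing.scale/=; field.
have zE z : z = al z *: ((p1, a * p1 + b) : plane R)
    + (1 - ga z - al z) *: ((q1, a * q1 + b) : plane R)
    + ga z *: ((w1, w2) : plane R).
  rewrite /al /ga; case: z => z1 z2 /=.
  rewrite !scale_pair; congr (_, _); rewrite /h /=; field; by rewrite pq w0.
apply: filterS2 al_near be_near => z al0 be0 ga0.
by rewrite (zE z); apply: convex_combination3 => //; lra.
Qed.

Lemma affine_residual (s a b : R) :
  affine (fun p => s * (p.2 - a * p.1 - b)).
Proof. by move=> t [p1 p2] [q1 q2]; rewrite !scale_pair /=; ring. Qed.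

Lemma affine_abscissa (s : R) : affine (fun p => s * p.1).
Proof. by move=> t [p1 p2] [q1 q2]; rewrite !scale_pair /=; ring. Qed.

Lemma segment_conv (p q : plane R) (t : R) :
  q + t *: (p - q) = t *: p + (1 - t) *: q.
Proof. by rewrite scalerBr scalerBl scale1r addrCA. Qed.

End hull.

(** * Vertices and edges of the polygon *)

Section polygon.
Context {R : realType} {m : nat} (x y : 'I_m -> R).
Context (x_inj : forall j k : 'I_m, j != k -> x j != x k).
Implicit Types (f g : plane R -> R) (i j k l : 'I_m).

Local Notation pt := (pt x y).
Local Notation r a b j := (y j - a * x j - b).

Lemma polygon_pt j : polygon x y (pt j).
Proof. by apply: sub_gen_smallest; exists j. Qed.

Lemma polygon_le f (c : R) : affine f -> (forall j, f (pt j) <= c) ->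
  forall p, polygon x y p -> f p <= c.
Proof.
move=> f_aff fc; apply: (@smallest_sub _ _ _ [set p | f p <= c]).
  exact: convex_halfplane.
by move=> _ [j _ <-]; exact: fc.
Qed.

(** All the other points lie in a lexicographic half-plane that does not contain
    [pt k].  Refining [f] by [g] produces vertices on a supporting line that
    contains several points, where no single one is exposed by [f]. *)
Lemma lex_max_vertex f g k : affine f -> affine g ->
  (forall j, f (pt j) <= f (pt k)) ->
  (forall j, j != k -> f (pt j) = f (pt k) -> g (pt j) < g (pt k)) ->
  vertices x y (pt k).
Proof.
move=> f_aff g_aff fk gk; exists k => // hull_k.
have [||] := hull_k [set p | f p < f (pt k) \/ f p = f (pt k) /\ g p < g (pt k)].
- split; first exact: convex_lex.
  move=> _ [j /= jk <-].
  have := fk j; rewrite le_eqVlt => /orP[/eqP fj|]; last by left.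
  by right; split=> //; exact: gk.
- by rewrite ltxx.
- by case=> _; rewrite ltxx.
Qed.

Lemma exists_lex_max_vertex f g : (0 < m)%N -> affine f -> affine g ->
  (forall j k, j != k -> g (pt j) != g (pt k)) ->
  exists k, [/\ vertices x y (pt k), forall j, f (pt j) <= f (pt k)
    & forall j, f (pt j) = f (pt k) -> g (pt j) <= g (pt k)].
Proof.
move=> m_gt0 f_aff g_aff g_inj.
have [k0 _ fmax] := @arg_maxP _ _ _ (Ordinal m_gt0) xpredT (f \o pt) isT.
have [k /eqP fk gmax] := @arg_maxP _ _ _ k0
  [pred j | f (pt j) == f (pt k0)] (g \o pt) (eqxx _).
have fle j : f (pt j) <= f (pt k) by rewrite fk; exact: fmax.
have gle j : f (pt j) = f (pt k) -> g (pt j) <= g (pt k).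
  by move=> fj; apply: gmax; rewrite /= fj fk.
exists k; split=> //; apply: (lex_max_vertex f_aff g_aff) => // j jk fj.
by rewrite lt_neqAle g_inj//= gle.
Qed.

(** Every affine function on the points attains its maximum at a vertex; this is
    what makes maxima over the vertices equal to maxima over all points. *)
Lemma exists_max_vertex f (i : 'I_m) : affine f ->
  exists k, vertices x y (pt k) /\ forall j, f (pt j) <= f (pt k).
Proof.
move=> f_aff.
have [||k [? ? _]] := exists_lex_max_vertex _ f_aff (affine_abscissa 1).
- exact: leq_ltn_trans (ltn_ord i).
- by move=> j k jk; rewrite /= !mul1r x_inj.
- by exists k.
Qed.

(** The vertices found are the leftmost and the rightmost point of the face of
    the polygon on which [f] is maximal. *)
Lemma face_two_vertices f (i j : 'I_m) : affine f -> i != j ->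
  f (pt i) = f (pt j) -> (forall l, f (pt l) <= f (pt i)) ->
  exists k l, [/\ k != l, vertices x y (pt k), vertices x y (pt l),
    f (pt k) = f (pt i) & f (pt l) = f (pt i)].
Proof.
move=> f_aff ij fij fmax.
have m_gt0 : (0 < m)%N by exact: leq_ltn_trans (ltn_ord i).
have [|k [vk fk gk]] := exists_lex_max_vertex m_gt0 f_aff (affine_abscissa 1).
  by move=> k l kl; rewrite /= !mul1r x_inj.
have [|l [vl fl gl]] := exists_lex_max_vertex m_gt0 f_aff (affine_abscissa (-1)).
  by move=> k' l kl; rewrite /= !mulN1r eqr_opp x_inj.
have fkE : f (pt k) = f (pt i) by apply: le_anti; rewrite fk fmax.
have flE : f (pt l) = f (pt i) by apply: le_anti; rewrite fl fmax.
exists k, l; split=> //; apply/eqP => kl; subst l.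
have /eqP := x_inj ij; apply.
have := gk i; have := gk j; have := gl i; have := gl j.
rewrite /= -fij fkE => /(_ erefl) h1 /(_ erefl) h2 /(_ erefl) h3 /(_ erefl) h4.
lra.
Qed.

Lemma linf_dist_le (a b e : R) : 0 <= e ->
  (forall j, `|r a b j| <= e) -> linf_dist x y a b <= e.
Proof. by move=> e0 re; apply: bigmax_le. Qed.

Lemma le_linf_dist (a b : R) j : `|r a b j| <= linf_dist x y a b.
Proof. exact: (le_bigmax _ (fun j => `|r a b j|)). Qed.

Lemma linf_dist_ge0 (a b : R) : 0 <= linf_dist x y a b.
Proof. exact: bigmax_ge_id. Qed.

(** Each absolute value is a residual up to sign, so it is bounded by the
    signed residual of some vertex. *)
Lemma linf_dist_verticesE (a b : R) :
  linf_dist_vertices x y a b = linf_dist x y a b.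
Proof.
apply: le_anti; apply/andP; split.
  by apply: bigmax_le => [|j _]; [exact: linf_dist_ge0|exact: le_linf_dist].
apply: linf_dist_le => [|j]; first exact: bigmax_ge_id.
pose s : R := if 0 <= r a b j then 1 else -1.
have [k [vk /(_ j) /= jk]] := exists_max_vertex j (affine_residual s a b).
apply: (@bigmax_sup _ _ _ _ k); first exact: mem_set.
move: jk; rewrite /s; case: ger0P => rj.
  by rewrite !mul1r => /le_trans; apply; exact: ler_norm.
by rewrite !mulN1r => /le_trans; apply; rewrite -normrN; exact: ler_norm.
Qed.

(** The edge value is the greatest vertical distance of a point to the line
    through the edge. *)
Lemma edge_distE k l : let a := (y k - y l) / (x k - x l) in
  edge_dist x y k l = linf_dist x y a (y k - a * x k).
Proof.
move=> a; rewrite -linf_dist_verticesE; apply: eq_bigr => j _.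
by congr `|_|; rewrite -/a; ring.
Qed.

Lemma support_segment f (w : plane R) k l : affine f ->
  (forall j, f (pt j) <= f (pt k)) -> f (pt l) = f (pt k) -> f (pt k) < f w ->
  segment (pt k) (pt l) `<=` boundary (polygon x y).
Proof.
move=> f_aff fmax fl fw _ [t + <-].
rewrite /= in_itv/= => /andP[t0 t1]; rewrite segment_conv.
have fz : f (t *: pt k + (1 - t) *: pt l) = f (pt k).
  by rewrite f_aff fl; ring.
apply: (@boundary_support _ _ f w) => //; last 2 first.
- by move=> q /(polygon_le f_aff fmax); rewrite fz.
- by rewrite fz.
apply: (@convex_set_conv _ (polygon x y)).
- exact: convex_hull_convex.
- by rewrite t0.
- exact: polygon_pt.
- exact: polygon_pt.
Qed.

(** Two points strictly on either side of the line of the edge span, together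
    with its ends, two triangles whose union is a neighbourhood of the midpoint
    of the edge. *)
Lemma boundary_edge_one_sided k l : boundary_edge x y k l ->
  let a := (y k - y l) / (x k - x l) in
  exists2 s : R, s = 1 \/ s = -1
    & forall j, 0 <= s * r a (y k - a * x k) j.
Proof.
move=> [kl _ _ bd] a; set b := y k - a * x k.
have xkl := x_inj kl.
have rk : (pt k).2 - a * (pt k).1 - b = 0 by rewrite /b /=; ring.
have rl : (pt l).2 - a * (pt l).1 - b = 0.
  by rewrite /b /a /=; field; rewrite subr_eq0.
apply: contrapT => two_sided.
have [i ri] : exists i, r a b i < 0.
  apply: contrapT => none; apply: two_sided; exists 1; first by left.
  by move=> j; rewrite mul1r leNgt; apply/negP => rj; apply: none; exists j.
have [j rj] : exists j, 0 < r a b j.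
  apply: contrapT => none; apply: two_sided; exists (-1); first by right.
  move=> j; rewrite mulN1r oppr_ge0 leNgt; apply/negP => rj.
  by apply: none; exists j.
have [] := bd (2^-1 *: pt k + (1 - 2^-1) *: pt l).
  exists 2^-1; last exact: segment_conv.
  by rewrite /= in_itv/=; apply/andP; split; lra.
move=> _; apply; rewrite /interior /=.
have near_i := near_midpoint_triangle (@convex_hull_convex _ _) (polygon_pt k)
  (polygon_pt l) (polygon_pt i) xkl rk rl (ltr0_neq0 ri).
have near_j := near_midpoint_triangle (@convex_hull_convex _ _) (polygon_pt k)
  (polygon_pt l) (polygon_pt j) xkl rk rl (lt0r_neq0 rj).
near=> z.
have [rz|/ltW rz] := leP 0 (z.2 - a * z.1 - b).
  have : 0 <= (z.2 - a * z.1 - b) / (y j - a * x j - b).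
    by rewrite divr_ge0// ltW.
  by near: z.
have : 0 <= (z.2 - a * z.1 - b) / (y i - a * x i - b).
  by rewrite mulr_le0// invr_le0 ltW.
by near: z.
Unshelve. all: by end_near.
Qed.

(** The parallel to the edge at half its value [D], on the side of the points,
    has all its residuals bounded by [D / 2]. *)
Lemma chebyshev_line_edge_dist a b e k l :
  chebyshev_line x y a b e -> boundary_edge x y k l ->
  2 * e <= edge_dist x y k l.
Proof.
move=> cheb edge; have [s s1 side] := boundary_edge_one_sided edge.
move: side; rewrite edge_distE.
set a' := _ / _; set b' := y k - a' * x k; set D := linf_dist _ _ _ _ => side.
suff : e <= D / 2 by lra.
apply: (chebyshev_line_le (a' := a') (b' := b' + s * (D / 2)) cheb) => j.
have := le_linf_dist a' b' j; rewrite -/D !ler_norml => /andP[h1 h2].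
have := side j; case: s1 => -> h; apply/andP; split; lra.
Qed.

Lemma linf_dist_chebyshev a b e : chebyshev_line x y a b e ->
  linf_dist x y a b = e.
Proof.
move=> cheb; apply: le_anti; apply/andP; split.
  have [re [u _]] := cheb; apply: linf_dist_le => //.
  exact: le_trans (normr_ge0 _) (re u).
by apply: chebyshev_line_le cheb _ => j; exact: le_linf_dist.
Qed.

(** The points [i] and [j] show that the line carrying the residuals [s * e]
    supports the polygon along a face that is not a single vertex. *)
Lemma alternation_edge (s a b e : R) i j l : s = 1 \/ s = -1 ->
  (forall n, `|r a b n| <= e) -> i != j ->
  s * r a b i = e -> s * r a b j = e -> s * r a b l = - e ->
  exists k1 k2 k3, [/\ boundary_edge x y k1 k2, vertices x y (pt k3)
    & [/\ s * r a b k1 = e, s * r a b k2 = e & s * r a b k3 = - e]].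
Proof.
move=> s1 re ij ri rj rl.
have bound n : - e <= s * r a b n <= e.
  by rewrite -ler_norml normrM; case: s1 => ->; rewrite ?normrN normr1 mul1r.
have f_aff := affine_residual s a b.
have [||k1 [k2 [k12 v1 v2 /= f1 f2]]] := face_two_vertices f_aff ij.
- by rewrite /= ri rj.
- by move=> n; rewrite /= ri; have /andP[] := bound n.
have [k3 [v3 /(_ l) /= f3]] := exists_max_vertex l (affine_residual (- s) a b).
exists k1, k2, k3; split=> //.
- split=> //.
  (* the residual at this point of the vertical axis is [s * (e + 1)] *)
  apply: (@support_segment _ (0, b + s * (e + 1)) _ _ f_aff) => /=.
  + by move=> n; rewrite f1 ri; have /andP[] := bound n.
  + by rewrite f1 f2.
  + by rewrite f1 ri; case: s1 => ->; lra.
- rewrite f1 f2 ri; split=> //.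
  by have /andP[] := bound k3; move: f3; rewrite !mulNr rl; lra.
Qed.

(** The high points [u] and [u'], or else the low points [d] and [d'], are
    distinct: if both pairs were the same, its high point would be on both
    sides of its low point. *)
Lemma chebyshev_line_edge a b e : chebyshev_line x y a b e ->
  exists s k1 k2 k3, [/\ s = 1 \/ s = -1, boundary_edge x y k1 k2,
    vertices x y (pt k3)
    & [/\ s * r a b k1 = e, s * r a b k2 = e & s * r a b k3 = - e]].
Proof.
move=> [re [u [d [u' [d' [du ud [uE dE] [uE' dE']]]]]]].
have [uu'|uu'] := eqVneq u u'; last first.
  have [|||k1 [k2 [k3 [? ? ?]]]] :=
    @alternation_edge 1 a b e u u' d (or_introl erefl) re uu'; try lra.
  by exists 1, k1, k2, k3; split=> //; left.
have [dd'|dd'] := eqVneq d d'; last first.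
  have [|||k1 [k2 [k3 [? ? ?]]]] :=
    @alternation_edge (-1) a b e d d' u (or_intror erefl) re dd'; try lra.
  by exists (-1), k1, k2, k3; split=> //; right.
by move: du ud; rewrite uu' dd' => /lt_trans h /h; rewrite ltxx.
Qed.

End polygon.

(** * The theorem *)

Theorem theorem6 (R : realType) (m : nat) (x y : 'I_m -> R)
    (hm : (2 <= m)%N) (hx : forall j k : 'I_m, j != k -> x j != x k) :
  (exists! ab : R * R,
      forall a b : R, linf_dist x y ab.1 ab.2 <= linf_dist x y a b) /\
  (exists mu nu : R,
      [/\ is_min [set v : R | exists a b : R, v = linf_dist x y a b] mu,
          is_min [set v : R | exists a b : R, v = linf_dist_vertices x y a b] mu,
          is_min [set v : R | exists k l : 'I_m,
                    boundary_edge x y k l /\ v = edge_dist x y k l] nu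
        & mu = 2^-1 * nu]) /\
  (forall a0 b0 : R,
      0 < linf_dist x y a0 b0 ->
      is_min [set v : R | exists a b : R, v = linf_dist x y a b]
        (linf_dist x y a0 b0) ->
      exists k1 k2 k3 : 'I_m,
        [/\ [/\ k1 != k2, k1 != k3 & k2 != k3],
            [/\ vertices x y (pt x y k1), vertices x y (pt x y k2)
              & vertices x y (pt x y k3)],
            [/\ linf_dist x y a0 b0 = `|y k1 - a0 * x k1 - b0|,
                linf_dist x y a0 b0 = `|y k2 - a0 * x k2 - b0|
              & linf_dist x y a0 b0 = `|y k3 - a0 * x k3 - b0|]
          & segment (pt x y k1) (pt x y k2) `<=` boundary (polygon x y)]).
Proof.
have [a [b [e cheb]]] := chebyshev_line_exists y hm hx.
have distE := linf_dist_chebyshev cheb.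
have emin a' b' : e <= linf_dist x y a' b'.
  by apply: chebyshev_line_le cheb _ => j; exact: le_linf_dist.
have euniq a' b' : linf_dist x y a' b' <= e -> a' = a /\ b' = b.
  move=> le_e; apply: (chebyshev_line_unique cheb) => j.
  exact: le_trans (le_linf_dist _ _ _ _ _) le_e.
have [s [k1 [k2 [k3 [s1 edge v3 [r1 r2 r3]]]]]] := chebyshev_line_edge hx cheb.
have [k12 v1 v2 bd12] := edge.
split; last split.
- exists (a, b); split=> [a' b' /=|[a' b'] /= min']; first by rewrite distE.
  by have [|-> ->] := euniq a' b'; first by rewrite -distE.
- exists e, (2 * e); split; last by rewrite mulKf.
  + by split; [exists a, b|move=> _ [a' [b' ->]]].
  + split; first by exists a, b; rewrite linf_dist_verticesE.
    by move=> _ [a' [b' ->]]; rewrite linf_dist_verticesE.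
  + split; last by move=> _ [k [l [kl ->]]]; exact: chebyshev_line_edge_dist cheb kl.
    exists k1, k2; split=> //; apply: le_anti.
    rewrite (chebyshev_line_edge_dist hx cheb edge)/= edge_distE//.
    have -> : (y k1 - y k2) / (x k1 - x k2) = a.
      apply: (canLR (mulfK _)); first by rewrite subr_eq0 hx.
      by case: s1 r1 r2 => ->; lra.
    have [re _] := cheb; apply: linf_dist_le => [|j].
      by rewrite mulr_ge0// -distE linf_dist_ge0.
    have := re j; rewrite !ler_norml => /andP[h1 h2].
    by case: s1 r1 => -> r1; apply/andP; split; lra.
- move=> a0 b0 f_gt0 [_ min0].
  have [|aE bE] := euniq a0 b0; first by apply: min0; exists a, b.
  move: f_gt0; rewrite {}aE {}bE distE => e_gt0.
  have normE k : s * (y k - a * x k - b) = e \/ s * (y k - a * x k - b) = - e ->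
      e = `|y k - a * x k - b|.
    move=> rk; have : `|s * (y k - a * x k - b)| = e.
      by case: rk => ->; rewrite ?normrN gtr0_norm.
    by rewrite normrM; case: s1 => ->; rewrite ?normrN normr1 mul1r.
  exists k1, k2, k3; split=> //; split=> //.
  + by apply: contra_eq_neq r1 => ->; rewrite r3; lra.
  + by apply: contra_eq_neq r2 => ->; rewrite r3; lra.
  + by apply: normE; left.
  + by apply: normE; left.
  + by apply: normE; right.
Qed.
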